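(* For $\mathcal{G}=(K_n)_{n\in\mathbb{N}}$, the sequence of complete graphs ($K_n$ being the complete graph on $n$ vertices), the function $t_{\mathcal{G}}(n)=n/(2\ln n)$ is a sharp DP-threshold function for $\mathcal{G}$.
   Context: All graphs are finite and simple. $\mathbb{N}=\{0,1,2,\ldots\}$ and $[k]=\{1,\ldots,k\}$. A (DP-)cover of a graph $G$ is a pair $\mathcal{H}=(L,H)$ where $H$ is a graph and $L:V(G)\to 2^{V(H)}$ is such that: $\{L(v):v\in V(G)\}$ is a partition of $V(H)$ into $|V(G)|$ independent sets; for each edge $uv\in E(G)$ the edges of $H$ between $L(u)$ and $L(v)$ form a matching; and $H$ has no other edges than those between $L(u)$ and $L(v)$ with $uv\in E(G)$. A transversal is a set $T\subseteq V(H)$ containing exactly one vertex of each $L(v)$; it is independent if it is an independent set in $H$. $G$ is $\mathcal{H}$-colorable if $\mathcal{H}$ has an independent transversal. For $k\in\mathbb{N}$, the random $k$-fold cover $\mathcal{H}(G,k)=(L,H)$ is defined by $L(v)=\{(v,i):i\in[k]\}$ for $v\in V(G)$ and, independently for each edge $uv\in E(G)$, the edges of $H$ between $L(u)$ and $L(v)$ form a perfect matching chosen uniformly at random among the $k!$ perfect matchings between $L(u)$ and $L(v)$ ($H$ has no other edges). Let $\mathcal{G}=(G_\lambda)_{\lambda\in\mathbb{N}}$ be a sequence of graphs and $\kappa=(k_\lambda)_{\lambda\in\mathbb{N}}$ a sequence with $k_\lambda\in\mathbb{N}$. $\mathcal{G}$ is $\kappa$-DP-colorable w.h.p. if $\lim_{\lambda\to\infty}\mathbb{P}(G_\lambda\text{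 is }\mathcal{H}(G_\lambda,k_\lambda)\text{-colorable})=1$, and non-$\kappa$-DP-colorable w.h.p. if this limit equals $0$. A function $t_{\mathcal{G}}:\mathbb{N}\to\mathbb{R}$ is a sharp DP-threshold function for $\mathcal{G}$ if for any $\varepsilon>0$ and any such $\kappa$: $\mathcal{G}$ is non-$\kappa$-DP-colorable w.h.p. when $k_\lambda\leq(1-\varepsilon)t_{\mathcal{G}}(\lambda)$ for all large enough $\lambda$, and $\mathcal{G}$ is $\kappa$-DP-colorable w.h.p. when $k_\lambda\geq(1+\varepsilon)t_{\mathcal{G}}(\lambda)$ for all large enough $\lambda$. Only large $\lambda$ matter, so values of $t_{\mathcal{G}}$ at the finitely many indices where the given formula is undefined may be chosen arbitrarily. *)

(* Defs.v *)
From HB Require Import structures.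
From mathcomp Require Import all_boot all_order all_algebra.
From mathcomp Require Import all_classical all_reals all_analysis.

Set Implicit Arguments.
Unset Strict Implicit.
Unset Printing Implicit Defensive.

Import Order.TTheory GRing.Theory Num.Theory.
Import numFieldNormedType.Exports.

Local Open Scope ring_scope.
Local Open Scope classical_set_scope.

Record sgraph := SGraph {
  vertex :> finType;
  adj : rel vertex;
  adj_sym : symmetric adj;
  adj_irr : irreflexive adj }.

Definition edges (G : sgraph) : {set {set G}} :=
  [set [set p.1; p.2] | p in [set p : G * G | adj p.1 p.2]]%SET.

Definition edge (G : sgraph) := {e : {set G} | e \in edges G}.

Definition independent (G : sgraph) (S : {set G}) : bool :=
  [forall x in S, forall y in S, ~~ adj x y].

Lemma complete_sym n : symmetric (fun u v : 'I_n => u != v).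
Proof. by move=> u v; rewrite eq_sym. Qed.

Lemma complete_irr n : irreflexive (fun u v : 'I_n => u != v).
Proof. by move=> u; rewrite eqxx. Qed.

Definition complete_graph (n : nat) : sgraph :=
  SGraph (@complete_sym n) (@complete_irr n).

(* Some L(v) may be empty (as in a 0-fold cover), so "partition" means that
   every vertex of H lies in exactly one L(v). The matching condition
   quantifies over both orientations of the edge uv. *)
Record cover (G : sgraph) := Cover {
  cover_graph : sgraph;
  cover_list : G -> {set cover_graph};
  cover_partition : forall x : cover_graph, exists! v, x \in cover_list v;
  cover_independent : forall v, independent (cover_list v);
  cover_matching : forall u v, adj u v ->
    forall x y z, x \in cover_list u -> y \in cover_list v ->
      z \in cover_list v -> adj x y -> adj x z -> y = z;
  cover_adj : forall x y : cover_graph, adj x y ->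
    exists u v, [/\ adj u v, x \in cover_list u & y \in cover_list v] }.

Definition transversal (G : sgraph) (C : cover G) (T : {set cover_graph C}) :
    bool :=
  [forall v, #|T :&: cover_list C v| == 1]%SET.

Definition cover_colorable (G : sgraph) (C : cover G) : bool :=
  [exists T : {set cover_graph C}, transversal T && independent T].

Section RandomCover.
Variables (G : sgraph) (k : nat).

Definition fiber (v : G) : {set G * 'I_k} := [set x | x.1 == v]%SET.

(* For e = {u, v}, a perfect matching between L(u) and L(v) is a partition of
   L(u) :|: L(v) into pairs, each with one vertex in L(u) and one in L(v). *)
Definition perfect_matching (e : {set G}) (M : {set {set G * 'I_k}}) : bool :=
  finset.partition M (\bigcup_(v in e) fiber v)%SET &&
  [forall m in M, forall v in e, #|m :&: fiber v| == 1]%SET.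

Definition pmatching (e : edge G) :=
  {M : {set {set G * 'I_k}} | perfect_matching (val e) M}.

Definition outcome := {dffun forall e : edge G, pmatching e}.

Definition outcome_adj (w : outcome) : rel (G * 'I_k) :=
  fun x y => [exists e : edge G, [set x; y]%SET \in val (w e)].

Lemma perfect_matching_pair (e : edge G) M x y :
  perfect_matching (val e) M -> [set x; y]%SET \in M ->
  adj x.1 y.1 /\ val e = [set x.1; y.1]%SET.
Proof.
case: e => e /= /imsetP[[u v]]; rewrite inE /= => uv -> /andP[/and3P[/eqP cM _ _]].
move=> /forall_inP Mpair mM.
have sub z : z \in [set x; y]%SET -> z.1 = u \/ z.1 = v.
  move=> zm; have : z \in finset.cover M.
    by apply/finset.bigcupP; exists [set x; y]%SET.
  rewrite cM => /finset.bigcupP[w]; rewrite !inE => wE /eqP ->.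
  by case/orP: wE => /eqP; [left|right].
have ex w : w \in [set u; v]%SET -> x.1 = w \/ y.1 = w.
  move=> wE; have /forall_inP/(_ w wE) := Mpair _ mM.
  move=> /cards1P[z] /setP/(_ z); rewrite !inE eqxx => /andP[zxy /eqP <-].
  by case/orP: zxy => /eqP ->; [left|right].
have nuv : u <> v by move=> E; rewrite E adj_irr in uv.
have := sub x; have := sub y; rewrite !inE !eqxx orbT => /(_ isT) Y /(_ isT) X.
have := ex u; have := ex v; rewrite !inE !eqxx orbT => /(_ isT) V /(_ isT) U.
have [[xu yv]|[xv yu]] : (x.1 = u /\ y.1 = v) \/ (x.1 = v /\ y.1 = u).
- by case: X Y U V => [] -> [] -> [] ? [] ?; subst; auto; congruence.
- by rewrite xu yv.
- by rewrite xv yu adj_sym finset.setUC.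
Qed.

Lemma outcome_adjP w x y : outcome_adj w x y ->
  exists e : edge G, [/\ [set x; y]%SET \in val (w e), adj x.1 y.1
    & val e = [set x.1; y.1]%SET].
Proof.
case/existsP=> e xye; exists e.
by have [] := perfect_matching_pair (valP (w e)) xye.
Qed.

Lemma outcome_sym w : symmetric (outcome_adj w).
Proof. by move=> x y; rewrite /outcome_adj finset.setUC. Qed.

Lemma outcome_irr w : irreflexive (outcome_adj w).
Proof. by move=> x; apply/negbTE/negP => /outcome_adjP[e [_]]; rewrite adj_irr. Qed.

Definition outcome_graph (w : outcome) : sgraph :=
  SGraph (@outcome_sym w) (@outcome_irr w).

Lemma fiber_partition (x : G * 'I_k) : exists! v, x \in fiber v.
Proof. by exists x.1; split=> [|v]; rewrite inE // => /eqP. Qed.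

Lemma fiber_independent w v : @independent (outcome_graph w) (fiber v).
Proof.
apply/forall_inP => x; rewrite inE => /eqP xv.
apply/forall_inP => y; rewrite inE => /eqP yv.
by apply/negP => /outcome_adjP[e [_]]; rewrite xv yv adj_irr.
Qed.

Lemma fiber_matching w u v : adj u v ->
  forall x y z : outcome_graph w, x \in fiber u -> y \in fiber v ->
    z \in fiber v -> adj x y -> adj x z -> y = z.
Proof.
move=> uv x y z; rewrite !inE => /eqP xu /eqP yv /eqP zv.
move=> /outcome_adjP[e [xye _ eE]] /outcome_adjP[f [xzf _ fE]].
have ef : f = e by apply/val_inj; rewrite eE fE xu yv zv.
rewrite {}ef in xzf.
have /andP[/and3P[_ /finset.trivIsetP tM _] _] := valP (w e).
have E : [set x; y]%SET = [set x; z]%SET.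
  apply/eqP/negPn/negP => /(tM _ _ xye xzf).
  by rewrite disjoint_subset => /fintype.subsetP/(_ x); rewrite !inE eqxx => /(_ isT).
have : y \in [set x; z]%SET by rewrite -E !inE eqxx orbT.
rewrite !inE => /orP[/eqP yx|/eqP //].
by move: uv; rewrite -xu -yv yx adj_irr.
Qed.

Lemma fiber_adj w (x y : outcome_graph w) : adj x y ->
  exists u v, [/\ adj u v, x \in fiber u & y \in fiber v].
Proof.
by move=> /outcome_adjP[e [_ xy _]]; exists x.1, y.1; rewrite !inE !eqxx.
Qed.

Definition random_cover (w : outcome) : cover G :=
  @Cover G (outcome_graph w) fiber fiber_partition (@fiber_independent w)
    (@fiber_matching w) (@fiber_adj w).

End RandomCover.

Section Probability.
Variable R : realType.

(* Product over the edges of the uniform distributions on perfect matchings. *)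
Definition outcome_prob (G : sgraph) (k : nat) (w : outcome G k) : R :=
  \prod_(e : edge G) (#|{: pmatching k e}|%:R)^-1.

Definition colorable_prob (G : sgraph) (k : nat) : R :=
  \sum_(w : outcome G k | cover_colorable (random_cover w)) outcome_prob w.

Definition DP_colorable_whp (G : nat -> sgraph) (k : nat -> nat) : Prop :=
  colorable_prob (G l) (k l) @[l --> \oo] --> (1 : R).

Definition non_DP_colorable_whp (G : nat -> sgraph) (k : nat -> nat) : Prop :=
  colorable_prob (G l) (k l) @[l --> \oo] --> (0 : R).

Definition sharp_DP_threshold (G : nat -> sgraph) (t : nat -> R) : Prop :=
  forall (eps : R) (k : nat -> nat), 0 < eps ->
    ((\forall l \near \oo, (k l)%:R <= (1 - eps) * t l) ->
      non_DP_colorable_whp G k) /\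
    ((\forall l \near \oo, (1 + eps) * t l <= (k l)%:R) ->
      DP_colorable_whp G k).

End Probability.

(* Main.v *)
Require Import Defs.
From mathcomp Require Import all_boot all_order all_algebra perm.
From mathcomp Require Import all_classical all_reals all_analysis.
From mathcomp Require Import ring lra.

Set Implicit Arguments.
Unset Strict Implicit.
Unset Printing Implicit Defensive.

Import Order.TTheory GRing.Theory Num.Theory.
Import numFieldNormedType.Exports.

Local Open Scope ring_scope.

(** Let X be the number of maps f choosing one of k colours at each vertex whose
graph is an independent transversal of the random cover. The threshold is where
the mean of X passes from 0 to infinity, and the first two moments decide both
sides.

Below the threshold. A fixed f survives a given edge with probability 1 - 1/k,
so E X = k^n (1 - 1/k)^C(n,2) <= exp(n ln n - C(n,2)/k). For
k <= (1 - eps) n / (2 ln n) the exponent is at most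
ln n (1 - eps n) / (1 - eps), and P(X > 0) <= E X <= 1 / (eps n)
([colorable_prob_complete_le]).

Above the threshold. By Cauchy-Schwarz, P(X > 0) >= (E X)^2 / E X^2
([second_moment]). A pair (f, g) survives an edge on which f and g agree with
probability 1 - 1/k, and any other edge with probability at most
1 - 2/k + 1/(k(k-1)) = (1 - 1/k)^2 (1 + 1/(k-1)^3). Hence E X^2 / (E X)^2 is at
most (1 + 1/(k-1)^3)^C(n,2), which tends to 1 because k is of order at least
n / ln n, times the mean of (1 + 1/(k-1))^C(s,2), where s is the number of
vertices at which a fixed f and a uniform g agree ([colorable_prob_ge]).

That mean tends to 1 as well. With L = ln n, the weight is at most
exp(s^2/(2(k-1))), which is 1 + o(1) for s <= L^2, and agreement sets larger than
L^2 contribute at most the sum over s of C(n,s) k^(-s) exp(s^2/(2(k-1))). Since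
C(n,s) <= (e n/s)^s, each of these terms is the s-th power of
(e n/(s(k-1))) exp(s/(2(k-1))), which is O(1/L) uniformly in s
([tail_base_le]): for s <= n/L the exponential is bounded, and for s > n/L it is
at most n^(1/(1+d)) where k - 1 >= (1 + d) n/(2L), which loses against the
prefactor O(L^2/n) because d > 0; this is where the constant factor above the
threshold enters. Altogether P(X > 0) >= 1 - O(1/L) ([colorable_prob_complete_ge]). *)

(** * Uniform permutations *)

(** The number of permutations sending [a] to [b] does not depend on [b], since
composing with a transposition moves [b] anywhere, and these numbers sum to
[k`!] over [b]. *)
Lemma card_perm_fix1 k (a b : 'I_k) :
  (k * #|[set s : 'S_k | s a == b]|)%N = k`!.
Proof.
have same b' : #|[set s : 'S_k | s a == b']| = #|[set s : 'S_k | s a == b]|.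
  have /on_card_preimset <- : {on [set s : 'S_k | s a == b],
      bijective (fun s : 'S_k => s * tperm b' b)%g}.
    exists (fun s => s * tperm b' b)%g => s _;
      by rewrite -mulgA tperm2 mulg1.
  apply: eq_card => s; rewrite !inE permM -{2}(tpermL b' b).
  by rewrite (inj_eq perm_inj).
rewrite -(card_Sn k) -[RHS]sum1_card.
rewrite (partition_big (fun s : 'S_k => s a) xpredT) //=.
transitivity (\sum_(b' < k) #|[set s : 'S_k | s a == b]|)%N.
  by rewrite sum_nat_const card_ord.
apply: eq_bigr => b' _; rewrite -(same b') -sum1_card.
by apply: eq_bigl => s; rewrite inE.
Qed.

(** The two constraints contradict each other when [a = a'] or [b = b'].
Otherwise the permutations sending [a] to [b] are spread evenly over the [k.-1]
remaining values at [a']. *)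
Lemma card_perm_fix2 k (a a' b b' : 'I_k) : (a, b) != (a', b') ->
  (k * k.-1 * #|[set s : 'S_k | (s a == b) && (s a' == b')]| <= k`!)%N.
Proof.
have [->|aa'] := eqVneq a a'.
  rewrite xpair_eqE eqxx /= => bb'; rewrite (_ : finset _ = finset.set0) ?cards0 ?muln0 //.
  apply/setP => s; rewrite !inE; apply/negP => /andP[/eqP E /eqP E'].
  by rewrite -E -E' eqxx in bb'.
have [->|bb' _] := eqVneq b b'.
  rewrite (_ : finset _ = finset.set0) ?cards0 ?muln0 //.
  apply/setP => s; rewrite !inE; apply/negP => /andP[/eqP <-].
  by rewrite eq_sym (inj_eq perm_inj) (negbTE aa').
pose N c := #|[set s : 'S_k | (s a == b) && (s a' == c)]|.
have same c : c != b -> N c = N b'.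
  move=> cb; rewrite /N.
  have /on_card_preimset <- : {on [set s : 'S_k | (s a == b) && (s a' == b')],
      bijective (fun s : 'S_k => s * tperm c b')%g}.
    exists (fun s => s * tperm c b')%g => s _;
      by rewrite -mulgA tperm2 mulg1.
  apply: eq_card => s; rewrite !inE !permM.
  have tb : tperm c b' b = b by rewrite tpermD // eq_sym.
  rewrite -[s a == b](inj_eq (@perm_inj _ (tperm c b'))) tb.
  by rewrite -[s a' == c](inj_eq (@perm_inj _ (tperm c b'))) tpermL.
rewrite -(card_perm_fix1 a b) -mulnA leq_mul2l; apply/orP; right.
rewrite -[leqRHS]sum1_card.
rewrite (partition_big (fun s : 'S_k => s a') xpredT) //=.
(* The value [b] at [a'] is impossible; its term is dropped. *)
rewrite (bigID (fun c => c == b)) /= -[leqLHS]add0n leq_add //.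
have -> : k.-1 = #|[pred c | c != b]|.
  by have := cardC1 b; rewrite card_ord => <-; apply: eq_card.
rewrite -sum_nat_const; apply: leq_sum => c cb.
rewrite -[X in (X <= _)%N]/(N b') -(same c cb) /N -sum1_card.
by apply: eq_leq; apply: eq_bigl => s; rewrite !inE.
Qed.

(** * Perfect matchings as permutations *)

Section Matching.
Variables (G : sgraph) (k : nat).
Implicit Types (e : edge G) (f g : {ffun G -> 'I_k}).

Lemma edge_ends e : exists u v : G, u != v /\ val e = [set u; v]%SET.
Proof.
case: e => e /= /imsetP[[u v]]; rewrite inE /= => uv ->.
by exists u, v; split=> //; apply/eqP => E; rewrite E adj_irr in uv.
Qed.

Definition perm_matching (u v : G) (s : 'S_k) : {set {set G * 'I_k}} :=
  [set [set (u, i); (v, s i)] | i : 'I_k]%SET.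

Lemma mem_perm_matching u v s i j : u != v ->
  ([set (u, i); (v, j)]%SET \in perm_matching u v s) = (s i == j).
Proof.
move=> uv; apply/imsetP/eqP => [[i' _ E]|<-]; last by exists i.
have : (u, i) \in [set (u, i'); (v, s i')]%SET by rewrite -E !inE eqxx.
have : (v, j) \in [set (u, i'); (v, s i')]%SET by rewrite -E !inE eqxx orbT.
rewrite !inE !xpair_eqE !eqxx (negbTE uv) eq_sym (negbTE uv) /= orbF.
by move=> /eqP -> /eqP ->.
Qed.

Lemma setI_pair_fiber (u v : G) (i j : 'I_k) : u != v ->
  ([set (u, i); (v, j)] :&: fiber k u = [set (u, i)])%SET.
Proof.
move=> uv; apply/setP => -[w l]; rewrite !inE !xpair_eqE /=.
by have [->|] := eqVneq w u; rewrite ?(negbTE uv) ?orbF ?andbT ?andbF.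
Qed.

Lemma perm_matchingP e (u v : G) s : u != v -> val e = [set u; v]%SET ->
  perfect_matching (val e) (perm_matching u v s).
Proof.
move=> uv ->; apply/andP; split; last first.
  apply/forall_inP => m /imsetP[i _ ->]; apply/forall_inP => w.
  rewrite !inE => /orP[] /eqP ->; first by rewrite setI_pair_fiber // cards1.
  by rewrite finset.setUC setI_pair_fiber 1?eq_sym // cards1.
apply/and3P; split.
- apply/eqP/setP => -[w i]; rewrite finset.bigcup_setU !finset.big_set1.
  apply/finset.bigcupP/idP => [[m /imsetP[j _ ->]]|].
    by rewrite !inE !xpair_eqE /= => /orP[] /andP[-> _] //; rewrite orbT.
  rewrite !inE /= => /orP[] /eqP ->.
    by exists [set (u, i); (v, s i)]%SET; [apply: imset_f | rewrite !inE eqxx].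
  exists [set (u, (s^-1)%g i); (v, s ((s^-1)%g i))]%SET; first exact: imset_f.
  by rewrite !inE permKV eqxx orbT.
- apply/finset.trivIsetP => m m' /imsetP[i _ ->] /imsetP[j _ ->] nij.
  have {}nij : i != j by apply: contraNneq nij => ->.
  apply/pred0P => -[w l]; rewrite /= !inE !xpair_eqE /=.
  have [->|] := eqVneq w u; rewrite ?(negbTE uv) /=.
    by rewrite !orbF; apply/negP => /andP[/eqP E /eqP E']; rewrite -E E' eqxx in nij.
  move=> _; have [_|//] := eqVneq w v.
  by rewrite /=; apply/negP => /andP[/eqP -> /eqP /perm_inj E]; rewrite E eqxx in nij.
- apply/imsetP => -[i _ /setP/(_ (u, i))]; by rewrite !inE eqxx.
Qed.

(** Each block of a perfect matching is a pair with one vertex over [u] and one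
over [v], so sending [i] to the colour matched with [(u, i)] is a map; it is
injective because the blocks are disjoint. *)
Lemma perm_matching_surj e (u v : G) M : u != v -> val e = [set u; v]%SET ->
  perfect_matching (val e) M -> exists s, M = perm_matching u v s.
Proof.
move=> uv eE /andP[]; rewrite eE => /and3P[/eqP cM tM _] /forall_inP Mpair.
rewrite finset.bigcup_setU !finset.big_set1 in cM.
have covu i : (u, i) \in finset.cover M by rewrite cM !inE /= eqxx.
have blockE m : m \in M -> exists i j, m = [set (u, i); (v, j)]%SET.
  move=> mM; have /forall_inP mf := Mpair _ mM.
  have /cards1P[[u' i] mu] := mf u (set21 _ _).
  have /cards1P[[v' j] mv] := mf v (set22 _ _).
  have u'E : u' = u.
    by have := set11 (u', i); rewrite -mu !inE => /andP[_ /eqP].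
  have v'E : v' = v.
    by have := set11 (v', j); rewrite -mv !inE => /andP[_ /eqP].
  subst u' v'; exists i, j; rewrite -mu -mv -finset.setIUr.
  apply/esym/finset.setIidPl; rewrite -cM; exact: finset.bigcup_sup.
have /fin_all_exists[t tP] i : exists j, [set (u, i); (v, j)]%SET \in M.
  have bM := finset.pblock_mem (covu i).
  have [i' [j E]] := blockE _ bM; exists j.
  have : (u, i) \in finset.pblock M (u, i) by rewrite finset.mem_pblock.
  rewrite E !inE !xpair_eqE (negbTE uv) eqxx /= orbF => /eqP ->.
  by rewrite -E.
have same m m' x : m \in M -> m' \in M -> x \in m -> x \in m' -> m = m'.
  move=> mM m'M xm xm'; apply/eqP/negPn/negP => /(finset.trivIsetP tM _ _ mM m'M).
  by move=> /pred0P/(_ x); rewrite /= xm xm'.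
have t_inj : injective t.
  move=> i i' tE; have := same _ _ (v, t i) (tP i) (tP i').
  rewrite tE !inE eqxx !orbT => /(_ isT isT) /setP/(_ (u, i)).
  by rewrite !inE !xpair_eqE (negbTE uv) !eqxx /= orbF => /esym/eqP.
exists (perm t_inj); apply/setP => m; apply/idP/imsetP => [mM|[i _ ->]]; last first.
  by rewrite permE.
have [i [j mE]] := blockE m mM; exists i => //; rewrite permE.
apply: (same _ _ (u, i)) => //; last by rewrite !inE eqxx.
by rewrite mE !inE eqxx.
Qed.

(** By this bijection, drawing a matching of [e] uniformly is drawing a uniform
permutation of the colours. *)
Lemma card_pmatching_pred e (u v : G) (P : pred {set {set G * 'I_k}}) :
  u != v -> val e = [set u; v]%SET ->
  #|[pred M : pmatching k e | P (val M)]|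
    = #|[set s : 'S_k | P (perm_matching u v s)]|.
Proof.
move=> uv eE.
pose F s : pmatching k e :=
  exist (perfect_matching (val e)) _ (perm_matchingP s uv eE).
have F_inj : injective F.
  move=> s s' /(congr1 val) /= E; apply/permP => i; apply/esym/eqP.
  by rewrite -(mem_perm_matching _ _ _ uv) -E mem_perm_matching.
rewrite -(card_imset _ F_inj); apply: eq_card => M; rewrite !inE.
apply/idP/imsetP => [PM|[s + ->]]; last by rewrite inE.
have [s ME] := perm_matching_surj uv eE (valP M).
by exists s; [rewrite inE -ME | apply/val_inj].
Qed.

Lemma card_pmatching e : #|{: pmatching k e}| = k`!.
Proof.
have [u [v [uv eE]]] := edge_ends e.
rewrite -card_Sn -(cardsT 'S_k) -(card_pmatching_pred xpredT uv eE).
by apply: eq_card.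
Qed.

(** Over an edge [e] this is the one pair of the cover that can spoil the
transversal given by [f]: that transversal is independent over [e] exactly when
the matching of [e] avoids this pair. *)
Definition trace f (e : {set G}) : {set G * 'I_k} := [set (x, f x) | x in e]%SET.

Lemma trace_pair f u v : trace f [set u; v] = [set (u, f u); (v, f v)]%SET.
Proof. by rewrite /trace finset.imsetU !finset.imset_set1. Qed.

Lemma card_trace_in e f :
  (k * #|[pred M : pmatching k e | trace f (val e) \in val M]|)%N = k`!.
Proof.
have [u [v [uv eE]]] := edge_ends e.
rewrite (card_pmatching_pred (fun M => trace f (val e) \in M) uv eE).
rewrite -(card_perm_fix1 (f u) (f v)); congr (_ * _)%N; apply: eq_card => s.
by rewrite !inE eE trace_pair mem_perm_matching.
Qed.

Lemma card_trace_in2 e f g : trace f (val e) != trace g (val e) ->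
  (k * k.-1 * #|[pred M : pmatching k e |
    (trace f (val e) \in val M) && (trace g (val e) \in val M)]| <= k`!)%N.
Proof.
have [u [v [uv eE]]] := edge_ends e => fg.
rewrite (card_pmatching_pred
  (fun M => (trace f (val e) \in M) && (trace g (val e) \in M)) uv eE).
have /card_perm_fix2 : (f u, f v) != (g u, g v).
  by apply: contraNneq fg => -[E1 E2]; rewrite eE !trace_pair E1 E2.
apply: leq_trans; rewrite leq_mul2l; apply/orP; right; apply: eq_leq.
by apply: eq_card => s; rewrite !inE eE !trace_pair !mem_perm_matching.
Qed.

End Matching.

(** * Moments of the number of proper colourings *)

(** Pointwise, the indicator of [P] is at least [2 l X - (l X)^2] for every [l],
because [(1 - l X)^2 >= 0]. The choice [l = 1 / (c E X)] makes the mean of this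
lower bound [2 / c - 1 / c]. *)
Lemma second_moment (R : realFieldType) (T : finType) (p X : T -> R)
    (P : pred T) (c : R) :
  (forall t, 0 <= p t) -> (forall t, ~~ P t -> X t = 0) ->
  0 < c -> 0 < \sum_t p t * X t ->
  \sum_t p t * X t ^+ 2 <= c * (\sum_t p t * X t) ^+ 2 ->
  c^-1 <= \sum_(t | P t) p t.
Proof.
set a := \sum_t p t * X t => p0 XP c0 a0 b_le.
pose l := (c * a)^-1.
apply: (@le_trans _ _ (\sum_t p t * (2 * l * X t - (l * X t) ^+ 2))).
  have -> : \sum_t p t * (2 * l * X t - (l * X t) ^+ 2)
      = 2 * l * a - l ^+ 2 * \sum_t p t * X t ^+ 2.
    rewrite /a !mulr_sumr -sumrB; apply: eq_bigr => t _; ring.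
  apply: (@le_trans _ _ (2 * l * a - l ^+ 2 * (c * a ^+ 2))).
    suff -> : 2 * l * a - l ^+ 2 * (c * a ^+ 2) = c^-1 by [].
    by rewrite /l; field; rewrite !gt_eqF.
  by rewrite lerB // ler_wpM2l // sqr_ge0.
rewrite [leRHS]big_mkcond; apply: ler_sum => t _ /=; case: ifPn => [_|/XP ->].
  rewrite ler_piMr // -subr_ge0 (_ : _ - _ = (1 - l * X t) ^+ 2) ?sqr_ge0 //; ring.
by rewrite !mulr0 expr0n subr0 mulr0.
Qed.

Section Moments.
Variables (R : realType) (G : sgraph) (k : nat).
Implicit Types (e : edge G) (f g : {ffun G -> 'I_k}) (w : outcome G k).

Lemma trace_edge e f u v : val e = [set u; v]%SET ->
  trace f (val e) = [set (u, f u); (v, f v)]%SET.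
Proof. by move=> ->; rewrite trace_pair. Qed.

Lemma card_avoid1 e f : (0 < k)%N ->
  #|[pred M : pmatching k e | trace f (val e) \notin val M]|%:R / k`!%:R
    = 1 - k%:R^-1 :> R.
Proof.
move=> k0; set A := [pred M : pmatching k e | trace f (val e) \in val M].
have kR : k%:R != 0 :> R by rewrite pnatr_eq0 -lt0n.
have fR : k`!%:R != 0 :> R by rewrite pnatr_eq0 -lt0n fact_gt0.
have /(congr1 (fun j => j%:R : R)) := cardC A; rewrite /= card_pmatching natrD.
have /(congr1 (fun j => j%:R : R)) := card_trace_in e f.
rewrite -/A /= natrM => E1 E2.
have -> : #|[pred M : pmatching k e | trace f (val e) \notin val M]|%:R
    = k`!%:R - #|A|%:R :> R.
  rewrite -E2 addrAC subrr add0r; congr _%:R; exact: eq_card.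
by rewrite mulrBl divff // -E1; field; rewrite kR /= -E1 mulf_eq0 (negbTE kR) /= in fR *.
Qed.

(** Inclusion-exclusion: one pair is matched with probability [1/k], both with
probability at most [1/(k(k-1))], and
[1 - 2/k + 1/(k(k-1)) = (1 - 1/k)^2 (1 + 1/(k-1)^3)]. The factored form isolates
the deviation from independence. *)
Lemma card_avoid2 e f g : (1 < k)%N -> trace f (val e) != trace g (val e) ->
  #|[pred M : pmatching k e | (trace f (val e) \notin val M)
      && (trace g (val e) \notin val M)]|%:R / k`!%:R
    <= (1 - k%:R^-1) ^+ 2 * (1 + (k.-1%:R ^+ 3)^-1) :> R.
Proof.
move=> k1 fg; set A := fun f => [pred M : pmatching k e | trace f (val e) \in val M].
set B := [pred M | _ && _].
have cA h : #|A h|%:R / k`!%:R = k%:R^-1 :> R.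
  have kR : k%:R != 0 :> R by rewrite pnatr_eq0 -lt0n (ltnW k1).
  have fR : k`!%:R != 0 :> R by rewrite pnatr_eq0 -lt0n fact_gt0.
  apply: (mulfI kR); rewrite mulrA -natrM card_trace_in !divff //.
have cAA : #|[predI A f & A g]|%:R / k`!%:R <= (k%:R * k.-1%:R)^-1 :> R.
  rewrite ler_pdivrMr ?ltr0n ?fact_gt0 // mulrC ler_pdivlMr; last first.
    by rewrite -natrM ltr0n muln_gt0; case: (k) k1 => [|[]].
  by rewrite mulrC -!natrM ler_nat; apply: card_trace_in2.
have : (#|B| + (#|A f| + #|A g|) = k`! + #|[predI A f & A g]|)%N.
  rewrite -cardUI -(card_pmatching k e) addnA -(cardC [predU A f & A g]).
  congr (_ + _)%N; rewrite addnC; congr (_ + _)%N.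
  by apply: eq_card => M; rewrite !inE negb_or.
move=> /(congr1 (fun j => j%:R / k`!%:R : R)); rewrite /= !natrD !mulrDl !cA.
rewrite divff ?pnatr_eq0 -?lt0n ?fact_gt0 // => E.
have -> : #|B|%:R / k`!%:R = 1 - k%:R^-1 * 2 + #|[predI A f & A g]|%:R / k`!%:R :> R.
  by lra.
apply: (le_trans (lerD (lexx _) cAA)).
rewrite le_eqVlt; apply/orP; left; apply/eqP.
case: (k) k1 => [//|m]; rewrite ltnS /= => m0.
have m1 : m%:R != 0 :> R by rewrite pnatr_eq0 -lt0n.
have m2 : m.+1%:R != 0 :> R by rewrite pnatr_eq0.
by rewrite -natr1 in m2 *; field; rewrite m1.
Qed.

Definition proper f w : bool :=
  [forall e : edge G, trace f (val e) \notin val (w e)].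

Lemma cover_colorableE w :
  cover_colorable (random_cover w) = [exists f, proper f w].
Proof.
apply/existsP/existsP => [[T /andP[/forallP T1 /forall_inP Tind]]|[f /forallP fP]].
  have /fin_all_exists[t tP] v : exists i, (v, i) \in T.
    have /cards1P[[u i]] := T1 v; move=> /setP/(_ (u, i)).
    by rewrite !inE /= eqxx => /andP[iT /eqP <-]; exists i.
  exists (finfun t); apply/forallP => e; have [u [v [uv eE]]] := edge_ends e.
  rewrite (trace_edge _ eE) !ffunE; apply/negP => ew.
  have /forall_inP/(_ _ (tP v))/negP := Tind _ (tP u); apply.
  by apply/existsP; exists e.
exists [set (v, f v) | v in [set: G]]%SET; apply/andP; split.
  apply/forallP => v; apply/cards1P; exists (v, f v); apply/setP => -[u i].
  rewrite !inE /= xpair_eqE; apply/andP/andP => -[].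
    by move=> /imsetP[u' _ [-> ->]] /eqP ->.
  by move=> /eqP -> /eqP ->; rewrite imset_f.
apply/forall_inP => x /imsetP[u _ ->]; apply/forall_inP => y /imsetP[v _ ->].
apply/negP => /outcome_adjP[e [ew _ /= eE]].
by have := fP e; rewrite (trace_edge _ eE) ew.
Qed.

Lemma outcome_prob_ge0 w : 0 <= outcome_prob R w.
Proof. by apply: prodr_ge0 => e _; rewrite invr_ge0. Qed.

(** The edges are independent: the measure is uniform, and a condition imposed on
each edge separately cuts out a box in the product of the sets of matchings. *)
Lemma sum_outcome_prob (B : forall e, pred (pmatching k e)) :
  \sum_(w : outcome G k | [forall e, B e (w e)]) outcome_prob R w
    = \prod_e (#|B e|%:R / k`!%:R).
Proof.
transitivity (\sum_(w : outcome G k | [forall e, B e (w e)])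
    \prod_(e : edge G) k`!%:R^-1 : R).
  by apply: eq_bigr => w _; apply: eq_bigr => e _; rewrite card_pmatching.
rewrite sumr_const -[LHS]mulr_natl big_split; congr (_ * _).
rewrite -natr_prod; congr _%:R.
have := @card_family _ (fun e : edge G => pmatching k e : finType) B.
by rewrite foldrE big_map big_enum => <-; apply: eq_card => w; rewrite inE.
Qed.

Definition count_proper w : R := \sum_f (proper f w)%:R.

Lemma sum_proper f g :
  \sum_w outcome_prob R w * ((proper f w)%:R * (proper g w)%:R)
  = \prod_e (#|[pred M : pmatching k e | (trace f (val e) \notin val M)
                 && (trace g (val e) \notin val M)]|%:R / k`!%:R).
Proof.
rewrite -sum_outcome_prob [RHS]big_mkcond; apply: eq_bigr => w _ /=.
have -> : [forall e, (trace f (val e) \notin val (w e))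
    && (trace g (val e) \notin val (w e))] = proper f w && proper g w.
  apply/forallP/andP => [P|[/forallP P /forallP Q] e]; last by rewrite P Q.
  by split; apply/forallP => e; have /andP[] := P e.
by case: (proper f w); case: (proper g w); rewrite ?mulr1 ?mulr0.
Qed.

(** Linearity of expectation, with independent edges for each colouring. *)
Lemma first_moment : (0 < k)%N ->
  \sum_w outcome_prob R w * count_proper w
    = k%:R ^+ #|G| * (1 - k%:R^-1) ^+ #|{: edge G}|.
Proof.
move=> k0; under eq_bigr => w _ do rewrite mulr_sumr.
rewrite exchange_big.
transitivity (\sum_(f : {ffun G -> 'I_k}) (1 - k%:R^-1) ^+ #|{: edge G}| : R).
  apply: eq_bigr => f _.
  transitivity (\sum_w outcome_prob R w * ((proper f w)%:R * (proper f w)%:R)).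
    by apply: eq_bigr => w _; case: (proper f w); rewrite ?mulr1 ?mulr0.
  rewrite sum_proper -prodr_const; apply: eq_bigr => e _.
  rewrite -(card_avoid1 e f k0); congr (_%:R / _).
  by apply: eq_card => M; rewrite !inE andbb.
by rewrite sumr_const -[LHS]mulr_natl card_ffun card_ord natrX.
Qed.

Lemma colorable_prob_le : (0 < k)%N ->
  colorable_prob R G k <= k%:R ^+ #|G| * (1 - k%:R^-1) ^+ #|{: edge G}|.
Proof.
move=> k0; rewrite -first_moment // /colorable_prob [leLHS]big_mkcond.
apply: ler_sum => w _ /=; case: ifPn => [|_].
  rewrite cover_colorableE => /existsP[f fw]; rewrite ler_peMr ?outcome_prob_ge0 //.
  by rewrite /count_proper (bigD1 f) //= fw lerDl sumr_ge0.
by rewrite mulr_ge0 ?outcome_prob_ge0 // sumr_ge0.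
Qed.

Definition agree f g : {set G} := [set x | f x == g x]%SET.

(** Equal traces on an edge force both of its ends into the agreement set, so
these edges are among the 2-subsets of that set. *)
Lemma card_agreeing_edges f g :
  (#|[pred e : edge G | trace f (val e) == trace g (val e)]|
    <= 'C(#|agree f g|, 2))%N.
Proof.
rewrite -cards_draws -(card_imset _ val_inj); apply/subset_leq_card.
apply/fintype.subsetP => A /imsetP[e]; rewrite !inE => /eqP fg ->.
apply/andP; split.
  apply/fintype.subsetP => x xe; rewrite inE.
  have : (x, f x) \in trace g (val e) by rewrite -fg imset_f.
  by move=> /imsetP[y _ [<- ->]].
by have [u [v [uv ->]]] := edge_ends e; rewrite cards2 uv.
Qed.

(** Relative to independent colourings, an edge of agreement costs the factor
[(1 - 1/k)^(-1) = 1 + 1/(k-1)], and every other edge at most [1 + 1/(k-1)^3]. *)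
Lemma sum_proper_le f g : (1 < k)%N ->
  \sum_w outcome_prob R w * ((proper f w)%:R * (proper g w)%:R)
  <= (1 - k%:R^-1) ^+ (2 * #|{: edge G}|)
     * ((1 + (k.-1%:R ^+ 3)^-1) ^+ #|{: edge G}|
        * (1 + k.-1%:R^-1) ^+ 'C(#|agree f g|, 2)).
Proof.
move=> k1; have k0 := ltnW k1; have pk0 : (0 < k.-1)%N by case: (k) k1 => [|[]].
have q0 : 0 <= 1 - k%:R^-1 :> R.
  by rewrite subr_ge0 invf_le1 ?ltr0n // ler1n.
have a1 : 1 <= 1 + k.-1%:R^-1 :> R by rewrite lerDl invr_ge0.
have b1 : 1 <= 1 + (k.-1%:R ^+ 3)^-1 :> R by rewrite lerDl invr_ge0 exprn_ge0.
pose A := [pred e : edge G | trace f (val e) == trace g (val e)].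
apply: (@le_trans _ _ (\prod_e ((1 - k%:R^-1) ^+ 2 * ((1 + (k.-1%:R ^+ 3)^-1)
    * (if e \in A then 1 + k.-1%:R^-1 else 1))))).
  rewrite sum_proper; apply: ler_prod => e _; rewrite divr_ge0 //= inE.
  case: ifPn => [/eqP fg|fg]; last by rewrite mulr1 card_avoid2.
  have -> : #|[pred M : pmatching k e | (trace f (val e) \notin val M)
      && (trace g (val e) \notin val M)]| =
    #|[pred M : pmatching k e | (trace f (val e) \notin val M)]|.
    by apply: eq_card => M; rewrite !inE fg andbb.
  rewrite card_avoid1 //.
  have E : (1 - k%:R^-1) * (1 + k.-1%:R^-1) = 1 :> R.
    case: (k) pk0 => // m /= m0.
    by rewrite -natr1; field; rewrite pnatr_eq0 -lt0n m0 natr1 pnatr_eq0.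
  rewrite expr2 -mulrA ler_peMr // mulrCA E mulr1 //.
rewrite !big_split /= !prodr_const -exprD addnn -mul2n -big_mkcond prodr_const.
rewrite ler_wpM2l ?exprn_ge0 // ler_wpM2l ?exprn_ge0 ?(le_trans ler01) //.
by rewrite ler_weXn2l // card_agreeing_edges.
Qed.

(** The edge factors of [sum_proper_le] come out of the double sum, and the powers
of [1 - 1/k] cancel against the squared first moment; what is left is the
agreement weight averaged over [g], uniformly in [f]. *)
Lemma colorable_prob_ge (c : R) : (1 < k)%N -> 0 < c ->
  (forall f, \sum_g (1 + k.-1%:R^-1) ^+ 'C(#|agree f g|, 2) <= k%:R ^+ #|G| * c) ->
  ((1 + (k.-1%:R ^+ 3)^-1) ^+ #|{: edge G}| * c)^-1 <= colorable_prob R G k.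
Proof.
move=> k1 c0 sum_le; have k0 := ltnW k1.
have q0 : 0 < 1 - k%:R^-1 :> R by rewrite subr_gt0 invf_lt1 ?ltr0n // ltr1n.
have b0 : 0 < 1 + (k.-1%:R ^+ 3)^-1 :> R by rewrite ltr_wpDr ?invr_ge0 ?exprn_ge0.
apply: (@second_moment _ _ _ count_proper).
- exact: outcome_prob_ge0.
- move=> w; rewrite cover_colorableE negb_exists => /forallP Nf.
  by apply: big1 => f _; rewrite (negbTE (Nf f)).
- by rewrite mulr_gt0 ?exprn_gt0.
- by rewrite first_moment // mulr_gt0 ?exprn_gt0 ?ltr0n.
rewrite first_moment //.
have -> : \sum_w outcome_prob R w * count_proper w ^+ 2 = \sum_f \sum_g
    \sum_w outcome_prob R w * ((proper f w)%:R * (proper g w)%:R).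
  under [RHS]eq_bigr => f _ do rewrite exchange_big.
  rewrite [RHS]exchange_big; apply: eq_bigr => w _ /=.
  rewrite expr2 {1}/count_proper mulr_suml mulr_sumr; apply: eq_bigr => f _.
  by rewrite /count_proper !mulr_sumr.
apply: (@le_trans _ _ (\sum_(f : {ffun G -> 'I_k}) (1 - k%:R^-1) ^+ (2 * #|{: edge G}|)
     * ((1 + (k.-1%:R ^+ 3)^-1) ^+ #|{: edge G}| * (k%:R ^+ #|G| * c)))).
  apply: ler_sum => f _; apply: (le_trans (ler_sum _ (fun g _ => sum_proper_le f g k1))).
  by rewrite -!mulr_sumr !ler_pM2l ?exprn_gt0.
rewrite sumr_const -[leLHS]mulr_natl card_ffun card_ord natrX le_eqVlt.
apply/orP; left; apply/eqP; rewrite mulnC exprM.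
set x := k%:R ^+ #|G|; set y := (1 - _) ^+ _; set z := (1 + _) ^+ _.
by move: x y z => x y z; ring.
Qed.

(** Such a [g] is determined on [S], which leaves at most [k] choices at each of
the other vertices. *)
Lemma card_agree_eq f (S : {set G}) :
  (#|[set g | agree f g == S]%SET| <= k ^ (#|G| - #|S|))%N.
Proof.
pose F x : pred 'I_k := if x \in S then pred1 (f x) else predT.
have -> : (k ^ (#|G| - #|S|) = #|family F|)%N.
  rewrite card_family foldrE big_map big_enum /= (bigID (mem S)) /=.
  have -> : (\prod_(x in S) #|F x| = 1)%N.
    by apply: big1 => x xS; rewrite /F xS card1.
  have -> : (\prod_(x | x \notin S) #|F x| = \prod_(x | x \notin S) k)%N.
    by apply: eq_bigr => x xS; rewrite /F (negbTE xS) card_ord.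
  rewrite mul1n prod_nat_const -(cardsC S) addKn; congr (k ^ _)%N.
  by apply: eq_card => x; rewrite !inE.
apply/subset_leq_card/fintype.subsetP => g; rewrite inE => /eqP gS.
by apply/familyP => x; rewrite /F -gS inE; case: eqP => [->|]; rewrite !inE.
Qed.

(** Colourings [g] agreeing with [f] on at most [t] vertices are counted trivially,
with weight at most [h t]. The others are counted by a union bound over the
agreement set, which is only efficient when that set is large. *)
Lemma sum_agree_le f (h : nat -> R) (t : nat) : (0 < k)%N ->
  (forall s, 0 <= h s) -> {homo h : s s' / (s <= s')%N >-> s <= s'} ->
  \sum_g h #|agree f g| <= k%:R ^+ #|G| *
    (h t + \sum_(s < #|G|.+1 | (t < s)%N) 'C(#|G|, s)%:R / k%:R ^+ s * h s).
Proof.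
move=> k0 h0 h_homo; rewrite (bigID (fun g => #|agree f g| <= t)%N) mulrDr /=.
apply: lerD.
  apply: (@le_trans _ _ (\sum_(g : {ffun G -> 'I_k}) h t)).
    rewrite big_mkcond; apply: ler_sum => g _; case: ifP => // gt.
    exact: h_homo.
  by rewrite sumr_const -[leLHS]mulr_natl card_ffun card_ord natrX.
have kR : k%:R != 0 :> R by rewrite pnatr_eq0 -lt0n.
rewrite (partition_big (agree f) (fun S => ~~ (#|S| <= t)%N)) //=.
apply: (@le_trans _ _ (\sum_(S : {set G} | ~~ (#|S| <= t)%N)
    k%:R ^+ (#|G| - #|S|) * h #|S|)).
  apply: ler_sum => S St.
  rewrite (eq_bigr (fun=> h #|S|)) => [|g /andP[_ /eqP ->] //].
  rewrite sumr_const -[leLHS]mulr_natl ler_wpM2r // -natrX ler_nat.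
  apply: leq_trans (card_agree_eq f S); apply/subset_leq_card/fintype.subsetP => g.
  by rewrite !inE => /andP[].
pose sz (S : {set G}) : 'I_#|G|.+1 := inord #|S|.
have szE S : sz S = #|S| :> nat by rewrite inordK // ltnS max_card.
rewrite (partition_big sz (fun s => (t < s)%N)) /= => [|S]; last by rewrite szE ltnNge.
rewrite mulr_sumr; apply: ler_sum => s ts.
rewrite (eq_bigr (fun=> k%:R ^+ (#|G| - s) * h s)) => [|S /andP[_ /eqP <-]]; last first.
  by rewrite szE.
rewrite sumr_const -[leLHS]mulr_natl !mulrA ler_wpM2r //.
rewrite [leRHS](_ : _ = 'C(#|G|, s)%:R * k%:R ^+ (#|G| - s)); last first.
  have sG : (s <= #|G|)%N by rewrite -ltnS.
  by rewrite exprB ?unitfE // mulrCA mulrA mulrAC.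
rewrite ler_wpM2r ?exprn_ge0 // ler_nat -card_draws.
apply/subset_leq_card/fintype.subsetP => S; rewrite !inE => /andP[_ /eqP <-].
by rewrite szE.
Qed.

End Moments.

(** * Elementary inequalities *)

Section Estimates.
Variable R : realType.
Implicit Types x y L c : R.

(** Growth of the exponential, used at [y] proportional to [ln n] to beat fixed
powers of [ln n]; the exponent 6 is the smallest that leaves a factor [ln n] to
spare against [(ln n)^5]. *)
Lemma expr6_le_expR y : 0 <= y -> y ^+ 6 <= 6 ^+ 6 * expR y.
Proof.
move=> y0; have -> : y = 6%:R * (y / 6) by field.
rewrite expRM_natl exprMn ler_wpM2l ?exprn_ge0 // lerXn2r ?nnegrE ?expR_ge0 ?divr_ge0 //.
by rewrite (le_trans _ (expR_ge1Dx _)) // lerDr.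
Qed.

Lemma expr1D_le_expR x n : 0 <= 1 + x -> (1 + x) ^+ n <= expR (n%:R * x).
Proof.
by move=> x0; rewrite expRM_natl lerXn2r ?nnegrE ?expR_ge0 ?expR_ge1Dx.
Qed.

Lemma natr_bin2 n : 'C(n, 2)%:R = n%:R * (n%:R - 1) / 2 :> R.
Proof.
have /(congr1 (fun j => j%:R : R)) := bin_ffact n 2.
rewrite /= natrM ffactnS ffactn1 natrM => E.
case: n E => [|n] E; first by rewrite bin0n /= !mul0r.
rewrite -[_ - 1]/(n.+1%:R - 1) -natr1 addrK natr1 -E.
by rewrite mulfK // pnatr_eq0.
Qed.

Lemma natr_bin2_le n : 'C(n, 2)%:R <= n%:R ^+ 2 / 2 :> R.
Proof. rewrite natr_bin2; have : 0 <= n%:R :> R by []. nra. Qed.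

(** A single term of the expansion of [(1 + s/n)^n <= exp s]. *)
Lemma bin_le_expR n s : (0 < s)%N -> (0 < n)%N ->
  'C(n, s)%:R <= (expR 1 * n%:R / s%:R) ^+ s :> R.
Proof.
move=> s0 n0; have [ns|sn] := ltnP n s.
  by rewrite bin_small // exprn_ge0 // divr_ge0 // mulr_ge0 ?expR_ge0.
have sR : 0 < s%:R :> R by rewrite ltr0n.
have nR : 0 < n%:R :> R by rewrite ltr0n.
have : (1 + s%:R / n%:R) ^+ n <= expR s%:R :> R.
  have := @expr1D_le_expR (s%:R / n%:R) n; rewrite mulrCA divff ?gt_eqF // mulr1.
  by apply; rewrite addr_ge0 // divr_ge0.
rewrite addrC exprDn (bigD1 (inord (n - s) : 'I_n.+1)) //=.
rewrite inordK ?ltnS ?leq_subr // subKn // expr1n mulr1 bin_sub // => le_e.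
have {}le_e : (s%:R / n%:R) ^+ s *+ 'C(n, s) <= expR s%:R :> R.
  apply: le_trans le_e; rewrite lerDl sumr_ge0 // => i _.
rewrite -[expR 1 * _ / _]mulrA exprMn -expRM_natl mulr1.
rewrite -[n%:R / s%:R]invf_div exprVn ler_pdivlMr ?exprn_gt0 ?divr_gt0 //.
by rewrite mulr_natl.
Qed.

Lemma sum_geometric_le x n : 0 <= x -> x <= 2^-1 ->
  \sum_(s < n.+1 | (0 < s)%N) x ^+ s <= 2 * x.
Proof.
move=> x0 x2; rewrite big_mkcond big_ord_recl /= add0r.
under eq_bigr => i _ do rewrite exprS.
rewrite -mulr_sumr mulrC ler_wpM2r //.
have := subrX1 x n; have : 0 <= x ^+ n by rewrite exprn_ge0.
have : 0 <= \sum_(i < n) x ^+ i by apply: sumr_ge0 => i _; rewrite exprn_ge0.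
nra.
Qed.

End Estimates.

(** * Complete graphs below the threshold *)

Section Complete.
Variable R : realType.

Lemma card_complete n : #|complete_graph n| = n.
Proof. exact: card_ord. Qed.

Lemma card_edge_complete n : #|{: edge (complete_graph n)}| = 'C(n, 2).
Proof.
rewrite card_sig -[in RHS](card_complete n) -card_draws; apply: eq_card => A; rewrite !inE.
apply/imsetP/cards2P => [[[u v]]|[u [v [uv ->]]]].
  by rewrite inE /= => uv ->; exists u, v.
by exists (u, v); rewrite ?inE.
Qed.

Lemma colorable_prob_ge0 (G : sgraph) k : 0 <= colorable_prob R G k.
Proof. by apply: sumr_ge0 => w _; apply: outcome_prob_ge0. Qed.

Lemma colorable_prob_le1 (G : sgraph) k : colorable_prob R G k <= 1.
Proof.
have fR : k`!%:R != 0 :> R by rewrite pnatr_eq0 -lt0n fact_gt0.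
have -> : 1 = \sum_(w : outcome G k) outcome_prob R w :> R.
  have := @sum_outcome_prob R G k (fun=> xpredT).
  rewrite [RHS]big1 => [|e _]; last by rewrite card_pmatching divff.
  by move=> <-; apply: eq_bigl => w; apply/forallP.
rewrite /colorable_prob big_mkcond; apply: ler_sum => w _.
by case: ifP => // _; apply: outcome_prob_ge0.
Qed.

Lemma colorable_prob0 n : (0 < n)%N -> colorable_prob R (complete_graph n) 0 = 0.
Proof.
case: n => // n _; apply: big1 => w; rewrite cover_colorableE => /existsP[f _].
by case: (f (ord0 : 'I_n.+1)).
Qed.

(** Markov's inequality and [1 - 1/k <= exp (- 1/k)] bound the probability by the
exponential of [n L - C(n,2)/k] with [L = ln n], which the bound on [k] makes at
most [L (1 - eps n) / (1 - eps) <= 1 - eps n]. *)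
Lemma colorable_prob_complete_le (eps : R) n k :
  1 <= ln n%:R :> R -> 1 <= eps * n%:R ->
  k%:R <= (1 - eps) * (n%:R / (2 * ln n%:R)) ->
  colorable_prob R (complete_graph n) k <= (eps * n%:R)^-1.
Proof.
set L := ln n%:R => L1 en1 kle.
have L0 : 0 < L by exact: lt_le_trans L1.
have n0 : (0 < n)%N by case: n @L en1 {L1 kle L0} => //; rewrite mulr0 ler10.
have nR : 1 <= n%:R :> R by rewrite ler1n.
have [->|] := posnP k; first by rewrite colorable_prob0 // invr_ge0 (le_trans ler01).
move=> k0; have kR : 1 <= k%:R :> R by rewrite ler1n.
apply: (le_trans (colorable_prob_le R _ k0)).
rewrite card_complete card_edge_complete.
have {}kle : k%:R * (2 * L) <= (1 - eps) * n%:R.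
  by rewrite -ler_pdivlMr ?mulr_gt0 // -mulrA.
have eps1 : 0 < 1 - eps by nra.
have eps0 : 0 < eps by nra.
have kn : k%:R <= n%:R :> R by nra.
have nE : expR L = n%:R by rewrite lnK // posrE ltr0n.
have q0 : 0 <= 1 - k%:R^-1 :> R by rewrite subr_ge0 invf_le1 // (lt_le_trans ltr01).
apply: (@le_trans _ _ (expR (n%:R * L) * expR ('C(n, 2)%:R * - k%:R^-1))).
  apply: ler_pM; rewrite ?exprn_ge0 //; last exact: expr1D_le_expR.
  by rewrite expRM_natl nE lerXn2r ?nnegrE.
rewrite -expRD.
apply: (@le_trans _ _ (expR (- (eps * n%:R - 1)))); last first.
  rewrite expRN lef_pV2 ?posrE ?expR_gt0 ?(lt_le_trans ltr01) //.
  by rewrite (le_trans _ (expR_ge1Dx _)) // addrC subrK.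
rewrite ler_expR natr_bin2.
have kinv : (n%:R - 1) * L / (1 - eps) <= n%:R * (n%:R - 1) / 2 * k%:R^-1.
  rewrite ler_pdivlMr ?(lt_le_trans ltr01) // mulrAC ler_pdivrMr //.
  have : 0 <= (n%:R - 1) * ((1 - eps) * n%:R - k%:R * (2 * L)).
    by rewrite mulr_ge0 // subr_ge0.
  lra.
rewrite mulrN; apply: (@le_trans _ _ (n%:R * L - (n%:R - 1) * L / (1 - eps))).
  by rewrite lerB.
have -> : n%:R * L - (n%:R - 1) * L / (1 - eps) = - ((eps * n%:R - 1) * L / (1 - eps)).
  by field; rewrite gt_eqF.
rewrite lerN2 ler_pdivlMr // ler_wpM2l ?subr_ge0 //.
lra.
Qed.

End Complete.

(** * Complete graphs above the threshold *)

Section Above.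
Variable R : realType.

(** The constant in the bound [tail_rate d / ln n] on the ratio of the geometric
series dominating large agreement sets. Its two summands come from the two
ranges of [s] in [tail_base_le]. *)
Definition tail_rate (d : R) : R :=
  2 * expR 1 ^+ 2 + 2 * expR 1 * 6 ^+ 6 / (d / (1 + d)) ^+ 6.

Lemma tail_rate_gt0 d : 0 < d -> 0 < tail_rate d.
Proof.
move=> d0; rewrite addr_gt0 // ?mulr_gt0 ?exprn_gt0 ?expR_gt0 //.
by rewrite invr_gt0 exprn_gt0 // divr_gt0 // addr_gt0.
Qed.

(** Here [L = ln n] and [m = k - 1]. If [s <= n/L], then [s/(2m)] is at most 1 and
[s >= L^2] gives a bound of order [L/s <= 1/L]. If [s > n/L], then [s <= n] gives
a bound of order [L^2/n * exp (L/(1+d)) = L^2 exp (- c L)] with [c = d/(1+d)]. *)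
Lemma tail_base_le (d L m n s : R) : 0 < d -> 1 <= L -> n = expR L ->
  (1 + d) * n <= m * (2 * L) -> L ^+ 2 <= s -> s <= n ->
  expR 1 * (n / m) / s * expR (s / (2 * m)) <= tail_rate d / L.
Proof.
move=> d0 L1 nE m_ge sL sn.
have L0 : 0 < L by exact: lt_le_trans L1.
have n0 : 0 < n by rewrite nE expR_gt0.
have d1 : 0 < 1 + d by rewrite addr_gt0.
have m0 : 0 < m by nra.
have s0 : 0 < s by apply: lt_le_trans sL; rewrite exprn_gt0.
have nm : n / m <= 2 * L by rewrite ler_pdivrMr //; nra.
have sm : s / (2 * m) <= s / n * (L / (1 + d)).
  rewrite ler_pdivrMr ?mulr_gt0 //.
  have -> : s / n * (L / (1 + d)) * (2 * m) = s * (m * (2 * L) / ((1 + d) * n)).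
    by field; rewrite !gt_eqF.
  by rewrite ler_peMr ?(ltW s0) // ler_pdivlMr ?mul1r // mulr_gt0.
have [c cE] : exists c, c = d / (1 + d) by exists (d / (1 + d)).
have c0 : 0 < c by rewrite cE divr_gt0.
have e0 : 0 < expR 1 :> R by rewrite expR_gt0.
rewrite /tail_rate -cE [leRHS]mulrDl; have [sLn|nsL] := leP (s * L) n.
  apply: (@le_trans _ _ (2 * expR 1 ^+ 2 / L)); last first.
    by rewrite lerDl !mulr_ge0 ?invr_ge0 ?exprn_ge0 ?(ltW e0) ?(ltW c0) ?(ltW L0).
  have e1 : expR (s / (2 * m)) <= expR 1.
    rewrite ler_expR (le_trans sm) // mulrA ler_pdivrMr // mul1r mulrAC.
    by rewrite ler_pdivrMr // (le_trans sLn) // ler_peMl ?(ltW n0) // lerDl ltW.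
  apply: (@le_trans _ _ (expR 1 * (2 * L) / s * expR 1)).
    apply: ler_pM; rewrite ?expR_ge0 // ?mulr_ge0 ?invr_ge0 ?(ltW e0) ?(ltW s0) ?(ltW n0) ?(ltW m0) //.
    by rewrite ler_wpM2r ?invr_ge0 ?(ltW s0) // ler_wpM2l // ltW.
  have -> : expR 1 * (2 * L) / s * expR 1 = 2 * expR 1 ^+ 2 * (L / s).
    by rewrite expr2; field; rewrite gt_eqF.
  rewrite ler_wpM2l ?mulr_ge0 ?exprn_ge0 ?(ltW e0) //.
  by rewrite ler_pdivrMr // mulrC ler_pdivlMr // -expr2.
apply: (@le_trans _ _ (2 * expR 1 * 6 ^+ 6 / c ^+ 6 / L)); last first.
  by rewrite lerDr !mulr_ge0 ?invr_ge0 ?exprn_ge0 ?(ltW e0) ?(ltW L0).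
have eL : expR (s / (2 * m)) <= expR (L / (1 + d)).
  rewrite ler_expR (le_trans sm) // ler_piMl ?divr_ge0 ?(ltW L0) ?(ltW d1) //.
  by rewrite ler_pdivrMr // mul1r.
apply: (@le_trans _ _ (expR 1 * (2 * L) * (L / n) * expR (L / (1 + d)))).
  apply: ler_pM; rewrite ?expR_ge0 // ?mulr_ge0 ?invr_ge0 ?(ltW e0) ?(ltW s0) ?(ltW n0) ?(ltW m0) //.
  apply: ler_pM; rewrite ?mulr_ge0 ?invr_ge0 ?(ltW e0) ?(ltW s0) ?(ltW n0) ?(ltW m0) //.
    by rewrite ler_wpM2l // ltW.
  by rewrite -[L / n]invf_div lef_pV2 ?posrE ?divr_gt0 // ler_pdivrMr // ltW.
have -> : expR 1 * (2 * L) * (L / n) * expR (L / (1 + d))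
    = 2 * expR 1 * (L ^+ 2 * expR (- (c * L))).
  have -> : - (c * L) = L / (1 + d) - L by rewrite cE; field; rewrite gt_eqF.
  by rewrite expRD expRN -nE; field; rewrite gt_eqF.
have -> : 2 * expR 1 * 6 ^+ 6 / c ^+ 6 / L
    = 2 * expR 1 * (6 ^+ 6 / (c ^+ 6 * L)).
  by field; rewrite !gt_eqF.
rewrite ler_wpM2l ?mulr_ge0 ?(ltW e0) //.
have := @expr6_le_expR _ (c * L) (mulr_ge0 (ltW c0) (ltW L0)).
rewrite exprMn => cL.
rewrite expRN ler_pdivlMr ?mulr_gt0 ?exprn_gt0 // mulrAC ler_pdivrMr ?expR_gt0 //.
apply: le_trans cL; have -> : L ^+ 2 * (c ^+ 6 * L) = c ^+ 6 * L ^+ 3 by ring.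
by rewrite ler_wpM2l ?exprn_ge0 ?(ltW c0) // ler_weXn2l.
Qed.

(** With [C(n,s) <= (e n/s)^s] and [(1 + 1/m)^C(s,2) <= exp (s/(2m))^s], the term
of index [s] is at most the [s]-th power of the quantity bounded by
[tail_base_le]; the condition [2 * tail_rate d <= L] keeps that ratio below 1/2. *)
Lemma tail_sum_le (d L m k : R) (n t : nat) : 0 < d -> 1 <= L -> n%:R = expR L ->
  (1 + d) * n%:R <= m * (2 * L) -> m <= k -> 2 * tail_rate d <= L ->
  (forall s, (t < s)%N -> L ^+ 2 <= s%:R) ->
  \sum_(s < n.+1 | (t < s)%N) 'C(n, s)%:R / k ^+ s * (1 + m^-1) ^+ 'C(s, 2)
    <= 2 * (tail_rate d / L).
Proof.
move=> d0 L1 nE m_ge mk rL tP.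
have L0 : 0 < L by exact: lt_le_trans L1.
have nR : 0 < n%:R :> R by rewrite nE expR_gt0.
have m0 : 0 < m by nra.
have k0 : 0 < k by apply: lt_le_trans mk.
have r0 := tail_rate_gt0 d0.
apply: le_trans (sum_geometric_le n (ltW (divr_gt0 r0 L0)) _); last first.
  by rewrite ler_pdivrMr // mulrC ler_pdivlMr // mulrC.
rewrite big_mkcond [leRHS]big_mkcond; apply: ler_sum => s _.
case: ifPn => [ts|_]; last by case: ifP => // _; rewrite exprn_ge0 // divr_ge0 // ltW.
have s0 : (0 < s)%N by apply: leq_trans ts.
have sR : 0 < s%:R :> R by rewrite ltr0n.
rewrite s0; apply: (@le_trans _ _
    ((expR 1 * (n%:R / m) / s%:R * expR (s%:R / (2 * m))) ^+ s)); last first.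
  have base0 : 0 <= expR 1 * (n%:R / m) / s%:R * expR (s%:R / (2 * m)).
    by rewrite !mulr_ge0 ?expR_ge0 ?invr_ge0 ?(ltW m0).
  rewrite lerXn2r ?nnegrE ?divr_ge0 ?(ltW r0) ?(ltW L0) //.
  by apply: tail_base_le => //; [exact: tP | rewrite ler_nat -ltnS].
rewrite exprMn; apply: ler_pM.
- by rewrite mulr_ge0 // invr_ge0 exprn_ge0 // (ltW k0).
- by rewrite exprn_ge0 // addr_ge0 // invr_ge0 ltW.
- have -> : expR 1 * (n%:R / m) / s%:R = expR 1 * n%:R / s%:R / m.
    by field; rewrite !gt_eqF.
  rewrite [leRHS]expr_div_n; apply: ler_pM => //.
  + by rewrite invr_ge0 exprn_ge0 // (ltW k0).
  + by rewrite bin_le_expR // -(ltr_nat R).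
  + by rewrite lef_pV2 ?posrE ?exprn_gt0 // lerXn2r ?nnegrE ?(ltW m0) ?(ltW k0).
rewrite (le_trans (expr1D_le_expR _ _)) ?addr_ge0 ?invr_ge0 ?(ltW m0) //.
rewrite -expRM_natl ler_expR.
apply: (@le_trans _ _ (s%:R ^+ 2 / 2 * m^-1)).
  by rewrite ler_wpM2r ?invr_ge0 ?(ltW m0) // natr_bin2_le.
by rewrite le_eqVlt; apply/orP; left; apply/eqP; field; rewrite gt_eqF.
Qed.

(** Agreement sets are split at size [L^2]. All error terms are at most
[u = (4 A + 2 D)/L], where [A = 6^6] controls powers of [L] against [n] and [D]
is the tail constant, so that the second moment ratio is at most
[exp u * (exp u + u) <= exp (3 u)] and the probability at least [1 - 3 u]. *)
Lemma colorable_prob_complete_ge (eps : R) : 0 < eps ->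
  exists K : R, forall n k : nat, K <= ln n%:R -> 1 <= ln n%:R :> R ->
    (1 + eps) * (n%:R / (2 * ln n%:R)) <= k%:R ->
    1 - K / ln n%:R <= colorable_prob R (complete_graph n) k.
Proof.
(* Half of [eps] is spent on passing from [k] to [k - 1]. *)
move=> eps0; pose d := eps / 2; have d0 : 0 < d by rewrite divr_gt0.
have [D DE] : exists D, D = tail_rate d by exists (tail_rate d).
have D0 : 0 < D by rewrite DE tail_rate_gt0.
have [A AE] : exists A : R, A = 6 ^+ 6 by exists (6 ^+ 6).
have A0 : 0 < A by rewrite AE exprn_gt0.
have Ad0 : 0 < A / d by rewrite divr_gt0.
(* The second summand makes [d * n >= 2 * L] when [K <= L]. *)
exists (3 * (4 * A + 2 * D) + 2 * (A / d)) => n k; set L := ln n%:R => KL L1 k_ge.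
have L0 : 0 < L by exact: lt_le_trans L1.
have n0 : (0 < n)%N.
  by rewrite lt0n; apply/eqP => n0; move: L1; rewrite /L n0 ln0 // ler10.
have nR : 0 < n%:R :> R by rewrite ltr0n.
have nE : n%:R = expR L by rewrite lnK // posrE.
have nA : L ^+ 6 <= A * n%:R by rewrite nE AE; apply: expr6_le_expR; exact: ltW.
have {}k_ge : (1 + eps) * n%:R <= k%:R * (2 * L).
  by rewrite -ler_pdivrMr ?mulr_gt0 // -mulrA.
have k0 : (0 < k)%N by case: k k_ge => // H; exfalso; nra.
pose m : R := k.-1%:R.
have kE : k%:R = m + 1 :> R by rewrite /m natr1 prednK.
have Lpow i j : (i <= j)%N -> L ^+ i <= L ^+ j by move=> ij; rewrite ler_weXn2l.
have nL : 2 * L <= d * n%:R.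
  have H : 2 * A * L <= d * A * n%:R.
    apply: (@le_trans _ _ (d * L ^+ 2)); last first.
      rewrite -mulrA ler_pM2l // (le_trans _ nA) // Lpow //.
    rewrite expr2 mulrA ler_wpM2r ?(ltW L0) //.
    have : A / d * 2 <= L by lra.
    by rewrite mulrAC ler_pdivrMr // mulrC [L * d]mulrC.
  by rewrite -(ler_pM2l A0); lra.
have m_ge : (1 + d) * n%:R <= m * (2 * L).
  have -> : (1 + d) * n%:R = (1 + eps) * n%:R - d * n%:R by rewrite /d; field.
  have -> : m = k%:R - 1 by rewrite kE addrK.
  lra.
have m0 : 0 < m by nra.
have k1 : (1 < k)%N by move: m0; rewrite /m ltr0n; case: (k) => [|[]].
pose t := Num.truncn (L ^+ 2).
have /andP[tL Lt] : t%:R <= L ^+ 2 < t.+1%:R by apply: truncn_itv; rewrite exprn_ge0 ?ltW.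
have minv : m^-1 <= 2 * L / n%:R.
  rewrite ler_pdivlMr // mulrC ler_pdivrMr // mulrC; nra.
pose u := (4 * A + 2 * D) / L.
have u0 : 0 < u by rewrite divr_gt0 // addr_gt0 // mulr_gt0.
have ratio i : (i <= 5)%N -> L ^+ i / n%:R <= A / L.
  move=> i5; rewrite ler_pdivrMr // mulrAC ler_pdivlMr // -exprSr.
  by rewrite (le_trans _ nA) // Lpow.
have AL0 : 0 < A / L by rewrite divr_gt0.
have DL0 : 0 < D / L by rewrite divr_gt0.
have uE : u = 4 * (A / L) + 2 * (D / L) by rewrite /u; field; rewrite gt_eqF.
have r5 : L ^+ 5 / n%:R <= u by have := ratio 5%N isT; lra.
have r3 : 4 * (L ^+ 3 / n%:R) <= u by have := ratio 3%N isT; lra.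
have rD : 2 * (D / L) <= u by lra.
have DL : 2 * D <= L by lra.
have low : (1 + m^-1) ^+ 'C(t, 2) <= expR u.
  rewrite (le_trans (expr1D_le_expR _ _)) ?addr_ge0 ?invr_ge0 ?(ltW m0) // ler_expR.
  apply: (@le_trans _ _ (L ^+ 4 / 2 * (2 * L / n%:R))).
    apply: ler_pM => //; rewrite ?invr_ge0 ?(ltW m0) //.
    rewrite (le_trans (natr_bin2_le _ _)) // ler_wpM2r ?invr_ge0 //.
    by rewrite -[4%N]/(2 * 2)%N exprM lerXn2r ?nnegrE // exprn_ge0 ?ltW.
  have -> : L ^+ 4 / 2 * (2 * L / n%:R) = L ^+ 5 / n%:R.
    by field; rewrite gt_eqF.
  exact: r5.
have edges_le : (1 + (m ^+ 3)^-1) ^+ 'C(n, 2) <= expR u.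
  rewrite (le_trans (expr1D_le_expR _ _)) ?addr_ge0 ?invr_ge0 ?exprn_ge0 ?(ltW m0) //.
  rewrite ler_expR; apply: (@le_trans _ _ (n%:R ^+ 2 / 2 * (2 * L / n%:R) ^+ 3)).
    apply: ler_pM => //; rewrite ?invr_ge0 ?exprn_ge0 ?(ltW m0) ?natr_bin2_le //.
    by rewrite -exprVn lerXn2r ?nnegrE ?invr_ge0 ?divr_ge0 ?mulr_ge0 ?(ltW m0) ?(ltW L0).
  have -> : n%:R ^+ 2 / 2 * (2 * L / n%:R) ^+ 3 = 4 * (L ^+ 3 / n%:R).
    by field; rewrite gt_eqF.
  exact: r3.
have tail : \sum_(s < n.+1 | (t < s)%N) 'C(n, s)%:R / k%:R ^+ s * (1 + m^-1) ^+ 'C(s, 2) <= u.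
  apply: (@le_trans _ _ (2 * (D / L))) => //.
  rewrite DE; apply: tail_sum_le => //; first by rewrite kE lerDl.
    by rewrite -DE.
  by move=> s ts; rewrite (le_trans (ltW Lt)) // ler_nat.
apply: (@le_trans _ _ ((1 + (m ^+ 3)^-1) ^+ 'C(n, 2) * expR (2 * u))^-1); last first.
  rewrite -card_edge_complete; apply: colorable_prob_ge; rewrite ?expR_gt0 // => f.
  have h_homo : {homo (fun s => (1 + m^-1) ^+ 'C(s, 2)) : s s' / (s <= s')%N >-> s <= s'}.
    by move=> s s' ss'; rewrite ler_weXn2l ?leq_bin2l // lerDl invr_ge0 ltW.
  have h0 s : 0 <= (1 + m^-1) ^+ 'C(s, 2) by rewrite exprn_ge0 // addr_ge0 ?invr_ge0 ?ltW.
  apply: le_trans (sum_agree_le f t k0 h0 h_homo) _.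
  rewrite card_complete ler_wpM2l ?exprn_ge0 //.
  apply: (@le_trans _ _ (expR u + u)); first by rewrite lerD.
  have -> : 2 * u = u + u by ring.
  rewrite expRD; move: (expR_ge1Dx u) (expR_ge0 u) u0; clear; nra.
apply: (@le_trans _ _ (expR (- (3 * u)))).
  apply: le_trans (expR_ge1Dx _); rewrite lerD // lerN2 /u mulrA ler_wpM2r ?invr_ge0 ?(ltW L0) //.
  by rewrite lerDl mulr_ge0 // ltW.
rewrite expRN lef_pV2 ?posrE ?mulr_gt0 ?expR_gt0 ?exprn_gt0 //; last first.
  by rewrite addr_gt0 // invr_gt0 exprn_gt0.
have -> : 3 * u = u + 2 * u by ring.
by rewrite expRD ler_wpM2r ?expR_ge0.
Qed.

Local Open Scope classical_set_scope.

Lemma near_ln_natr (A : R) : \forall n \near \oo, A <= ln n%:R :> R.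
Proof.
near=> n; rewrite -[A]expRK ler_ln ?posrE ?expR_gt0 //; last first.
  by near: n; exact: nbhs_infty_gtr.
by near: n; exact: nbhs_infty_ger.
Unshelve. all: by end_near. Qed.

Lemma cvg_div_pinfty (u : R ^nat) (c : R) :
  u n @[n --> \oo] --> +oo -> c / u n @[n --> \oo] --> 0.
Proof.
move=> uy; rewrite -(mulr0 c); apply: cvgMr.
by apply/(gtr0_cvgV0 _).2 => //; exact: (cvgryPgt _).1 uy 0.
Qed.

End Above.

Theorem corollary1p6 (R : realType) :
  @sharp_DP_threshold R complete_graph (fun n => n%:R / (2 * ln n%:R)).
Proof.
move=> eps k eps0; split=> kt.
  apply: (@squeeze_cvgr _ _ _ _ (fun=> 0) (fun n => eps^-1 / n%:R)).
  - near=> n; rewrite colorable_prob_ge0 -invfM /=.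
    apply: colorable_prob_complete_le.
    + by near: n; exact: near_ln_natr.
    + rewrite mulrC -ler_pdivrMr // mul1r; near: n; exact: nbhs_infty_ger.
    + by near: n.
  - exact: cvg_cst.
  - by apply: cvg_div_pinfty; exact: cvgr_idn.
have [K KP] := colorable_prob_complete_ge eps0.
apply: (@squeeze_cvgr _ _ _ _ (fun n => 1 - K / ln n%:R) (fun=> 1)).
- near=> n; rewrite colorable_prob_le1 andbT; apply: KP.
  + by near: n; exact: near_ln_natr.
  + by near: n; exact: near_ln_natr.
  + by near: n.
- rewrite -[X in (_ --> X)%classic]subr0; apply: cvgB; first exact: cvg_cst.
  by apply: cvg_div_pinfty; apply/cvgryPge => A; exact: near_ln_natr.
- exact: cvg_cst.
Unshelve. all: by end_near. Qed.
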